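(* For $q\in(0,1)$, define $f_q:[q,1]\to\mathbb{R}_+$ by $f_q(p)=D(p\|q)$, where $D(p\|q)$ is the binary KL divergence. Then $f_q(p)$ is a strictly increasing function of $p$. Moreover, let $P$ and $Q$ be any two probability distributions on an alphabet $\mathcal{Z}$ and let $E\subseteq\mathcal{Z}$ be any event with $Q(E)\in(0,1)$ and $D(P\|Q)\le\log\frac{1}{Q(E)}$. Then $$P(E)\le f_{Q(E)}^{-1}\big(D(P\|Q)\big).$$ In particular, for any joint distribution $P_{XY}$ on $\mathcal{X}\times\mathcal{Y}$ with marginals $P_X$, $P_Y$ and any event $E\subseteq\mathcal{X}\times\mathcal{Y}$ with $P_XP_Y(E)\in(0,1)$ and $I(X;Y)\le\log\frac{1}{P_XP_Y(E)}$, $$P_{XY}(E)\le f_{P_XP_Y(E)}^{-1}\big(I(X;Y)\big).$$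
   Context: Logarithms are natural. $D(P\|Q)$ is the Kullback–Leibler divergence. For $p\in[0,1]$ and $q\in(0,1)$, $D(p\|q)=p\log\frac{p}{q}+(1-p)\log\frac{1-p}{1-q}$ (with $0\log 0=0$) is the KL divergence between $\mathrm{Ber}(p)$ and $\mathrm{Ber}(q)$. $f_q^{-1}$ is the inverse of $f_q$ defined on its range $[0,\log(1/q)]$, with values in $[q,1]$. $P_XP_Y$ denotes the product of the marginals of $P_{XY}$, and $I(X;Y)=D(P_{XY}\|P_XP_Y)$ is the mutual information. *)

(* Defs.v *)
From HB Require Import structures.
From mathcomp Require Import all_boot all_order all_algebra.
From mathcomp Require Import all_classical all_reals all_analysis.
Set Implicit Arguments.
Unset Strict Implicit.
Unset Printing Implicit Defensive.
Import Order.TTheory GRing.Theory Num.Theory.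
Import numFieldNormedType.Exports.
Local Open Scope classical_set_scope.
Local Open Scope ring_scope.

(** The convention [0 log 0 = 0] holds because the factor [p] (resp. [1 - p])
    vanishes. *)
Definition binary_kl (R : realType) (p q : R) : R :=
  p * ln (p / q) + (1 - p) * ln ((1 - p) / (1 - q)).

Definition f_ (R : realType) (q p : R) : R := binary_kl p q.

(** On the range [f_ q @` `[q, 1]] this is the inverse of [f_ q] with values in
    [`[q, 1]]; outside of the range its value is irrelevant. *)
Definition finv_ (R : realType) (q : R) : R -> R := pinv `[q, 1] (f_ q).

(** D(P || Q) is the P-integral of log (dP/dQ) if P << Q and +oo otherwise.
    The derivative is finite everywhere when P << Q, and it is positive
    P-almost everywhere, so the totalization of [ln] is harmless. *)
Definition kl_divergence (d : measure_display) (T : measurableType d)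
    (R : realType) (P Q : probability T R) : \bar R :=
  if pselect (P `<< Q) then
    (\int[P]_x
      (ln (fine (Radon_Nikodym (charge_of_finite_measure P) Q x)))%:E)%E
  else +oo%E.

Section joint_distribution.
Context (d1 d2 : measure_display) (X : measurableType d1)
  (Y : measurableType d2) (R : realType).

Definition proj1_mfun : X * Y -> X := fst.
Definition proj2_mfun : X * Y -> Y := snd.

HB.instance Definition _ :=
  isMeasurableFun.Build _ _ _ _ proj1_mfun measurable_fst.
HB.instance Definition _ :=
  isMeasurableFun.Build _ _ _ _ proj2_mfun measurable_snd.

Variable P : probability (X * Y)%type R.

Definition marginal1 : probability X R := distribution P proj1_mfun.
Definition marginal2 : probability Y R := distribution P proj2_mfun.

Definition product_of_marginals : probability (X * Y)%type R :=
  (marginal1 \x marginal2)%E.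

Definition mutual_information : \bar R := kl_divergence P product_of_marginals.

End joint_distribution.

(* Main.v *)
(** Writing [h] for log (dP/dQ), the tangent bound h >= log c + 1 - c e^(-h) with
    c = P(E)/Q(E), integrated over E against P, gives
    [\int_E h dP >= P(E) log (P(E)/Q(E))], because the P-integral of
    e^(-h) = dQ/dP over E is at most Q(E). Adding the bounds for E and its
    complement yields D(P(E) || Q(E)) <= D(P || Q), and the claim follows by
    inverting [f_ q], which is increasing on [[q, 1]]. *)
Require Import Defs.
From HB Require Import structures.
From mathcomp Require Import all_boot all_order all_algebra.
From mathcomp Require Import all_classical all_reals all_analysis.
From mathcomp Require Import measurable_realfun ring lra.
Set Implicit Arguments.
Unset Strict Implicit.
Unset Printing Implicit Defensive.
Import Order.TTheory GRing.Theory Num.Theory.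
Import numFieldNormedType.Exports.
Local Open Scope classical_set_scope.
Local Open Scope ring_scope.

(** * Binary divergence: monotonicity and range *)

(** This is [ln t <= t - 1] at [t = q / p], multiplied by [p]. Summing it over an event and its
    complement cancels the left sides. *)
Lemma le_sub_mulr_ln_div (R : realType) (p q : R) :
  0 <= p -> 0 < q -> p - q <= p * ln (p / q).
Proof.
rewrite le_eqVlt => /predU1P[<- q0|p0 q0]; first by rewrite mul0r; lra.
have qp0 : 0 < q / p by rewrite divr_gt0.
have : ln (q / p) <= q / p - 1.
  have := @le_ln1Dx R (q / p - 1); rewrite addrCA subrr addr0; apply; lra.
rewrite -[p / q]invf_div lnV ?posrE// -(ler_pM2l p0) mulrBr mulr1 mulrCA.
by rewrite divff ?gt_eqF//; lra.
Qed.

Lemma binary_kl_ge0 (R : realType) (p q : R) :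
  0 <= p <= 1 -> 0 < q < 1 -> 0 <= binary_kl p q.
Proof.
move=> /andP[p0 p1] /andP[q0 q1]; rewrite /binary_kl.
have h1 := @le_sub_mulr_ln_div R p q p0 q0.
have := @le_sub_mulr_ln_div R (1 - p) (1 - q).
by rewrite !subr_ge0 subr_gt0 => /(_ p1 q1); lra.
Qed.

(** The factor of [p - r] is the derivative of [f_ q] at [r], so this is a first-order expansion
    with remainder [binary_kl p r]. It gives monotonicity without differentiating. *)
Lemma binary_kl_pythagoras (R : realType) (p r q : R) :
  0 < p <= 1 -> 0 < r < 1 -> 0 < q < 1 ->
  binary_kl p q = binary_kl p r + binary_kl r q
    + (p - r) * (ln (r / q) - ln ((1 - r) / (1 - q))).
Proof.
move=> /andP[p0 p1] /andP[r0 r1] /andP[q0 q1]; rewrite /binary_kl.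
have r1' : 0 < 1 - r by lra.
have q1' : 0 < 1 - q by lra.
(* At [p = 1] the logarithm of the quotient does not split, but its factor [1 - p] vanishes. *)
move: p1; rewrite le_eqVlt => /predU1P[->|p1].
  by rewrite subrr !mul0r !(ln_div, posrE)//= ln1; ring.
have {}p1 : 0 < 1 - p by lra.
rewrite !(ln_div, posrE)//.
by ring.
Qed.

Lemma f_strictly_increasing (R : realType) (q : R) : 0 < q < 1 ->
  {in `[q, 1] &, {homo f_ q : x y / x < y}}.
Proof.
move=> q01; have /andP[q0 q1] := q01; rewrite /f_.
(* Expand around [x]: the remainder is nonnegative and the slope at [x] is positive once [q < x]. *)
have step x y : q < x -> x < y -> y <= 1 -> binary_kl x q < binary_kl y q.
  move=> qx xy y1.
  have kl_yx : 0 <= binary_kl y x by apply: binary_kl_ge0; apply/andP; split; lra.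
  have lnx : 0 < ln (x / q) by rewrite ln_gt0// ltr_pdivlMr// mul1r.
  have ln1x : ln ((1 - x) / (1 - q)) < 0.
    by rewrite ln_lt0// divr_gt0 ?ltr_pdivrMr ?mul1r; lra.
  rewrite (@binary_kl_pythagoras R y x q) ?q01//; first last.
  - by apply/andP; split; lra.
  - by apply/andP; split; lra.
  have : 0 < (y - x) * (ln (x / q) - ln ((1 - x) / (1 - q))).
    by rewrite mulr_gt0; lra.
  by lra.
(* At [x = q] the slope of [f_ q] vanishes: go through the midpoint. *)
move=> x y /[!in_itv]/= /andP[+ _] /andP[_ y1] xy.
rewrite le_eqVlt => /predU1P[qx|qx]; last exact: step.
have -> : binary_kl x q = 0.
  by rewrite /binary_kl -qx !divff ?ln1 ?mulr0 ?addr0//; lra.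
apply: (@le_lt_trans _ _ (binary_kl ((x + y) / 2) q)); last by apply: step; lra.
by apply: binary_kl_ge0 => //; apply/andP; split; lra.
Qed.

(** Continuity at 0 is what [f_ q] needs at the endpoint 1. To the left of 0 the function is
    constant, since [ln] is 0 there; to the right it lies between [- 2 * Num.sqrt y] and 0. *)
Lemma continuous_mulr_ln (R : realType) : continuous (fun x : R => x * ln x).
Proof.
move=> x; have [x0|x0|->] := ltgtP x 0.
- rewrite /continuous_at ln0 ?ltW// mulr0.
  apply: cvg_near_cst; near=> y.
  by rewrite ln0 ?mulr0// ltW//; near: y; exact: lt_nbhsl.
- by apply: cvgM; [exact: cvg_id|exact: continuous_ln].
rewrite /continuous_at mul0r.
apply: (@squeeze_cvgr _ _ _ _ (fun y => - (2 * Num.sqrt y)) (fun=> 0));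
    last exact: cvg_cst.
  near=> y; have [y0|y0] := leP y 0.
    by rewrite ln0// mulr0 ler0_sqrtr// mulr0 oppr0 lexx.
  have sy0 : 0 < Num.sqrt y by rewrite sqrtr_gt0.
  have y1 : y <= 1 by apply/ltW; near: y; exact: lt_nbhsl.
  rewrite mulr_ge0_le0 ?ln_le0 ?(ltW y0)// andbT.
  have -> : y * ln y = Num.sqrt y ^+ 2 * (ln (Num.sqrt y) *+ 2).
    by rewrite -lnXn// sqr_sqrtr// ltW.
  (* Apply [ln t < t] at the inverse of [Num.sqrt y]. *)
  have := @ln_sublinear R _ (_ : 0 < (Num.sqrt y)^-1).
  rewrite invr_gt0 lnV ?posrE// => /(_ sy0) lny.
  have : Num.sqrt y ^+ 2 * - ln (Num.sqrt y) <= Num.sqrt y.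
    rewrite -ler_pdivlMl ?exprn_gt0// (le_trans (ltW lny))//.
    by rewrite expr2 invfM mulfVK// gt_eqF.
  by rewrite mulr2n; lra.
rewrite -[X in _ --> X]oppr0 -[X in _ --> - X](mulr0 2); apply: cvgN.
apply: cvgM; first exact: cvg_cst.
by rewrite -[X in _ --> X](@sqrtr0 R); exact: sqrt_continuous.
Unshelve. all: by end_near. Qed.

(** Monotonicity bounds the values by those at the endpoints, and the intermediate value theorem
    attains everything between. *)
Lemma f_image (R : realType) (q : R) : 0 < q < 1 ->
  f_ q @` `[q, 1] = `[0, ln (1 / q)]%classic.
Proof.
move=> q01; have /andP[q0 q1] := q01.
have fq : f_ q q = 0.
  by rewrite /f_ /binary_kl !divff ?ln1 ?mulr0 ?addr0//; lra.
have f1 : f_ q 1 = ln (1 / q) by rewrite /f_ /binary_kl subrr !mul0r mul1r addr0.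
have fmono := f_strictly_increasing q01.
have fle : {in `[q, 1] &, {homo f_ q : x y / x <= y}}.
  move=> x y xq yq; rewrite le_eqVlt => /predU1P[->//|xy].
  exact/ltW/fmono.
have qq : q \in `[q, 1] by rewrite in_itv/= lexx ltW.
have q1q : 1 \in `[q, 1] by rewrite in_itv/= lexx ltW.
apply/seteqP; split => [_ [x xq <-]|v /=].
  have /andP[qx x1] : q <= x <= 1 by move: xq; rewrite /= in_itv.
  rewrite /= in_itv/= -fq -f1; apply/andP; split; exact: fle.
rewrite in_itv/= => /andP[v0 v1].
have [| |c cq <-] := @IVT R (f_ q) q 1 v (ltW q1); last by exists c.
  apply: continuous_subspaceT => x.
  (* Rescaling writes both terms as [t * ln t] composed with an affine map, which is continuous even
     where [t] is 0. *)
  have -> : f_ q = (fun p => q * (p / q * ln (p / q)) +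
      (1 - q) * ((1 - p) / (1 - q) * ln ((1 - p) / (1 - q)))).
    apply/funext => p; rewrite /f_ /binary_kl; field.
    by apply/andP; split; rewrite gt_eqF//; lra.
  apply: cvgD; apply: cvgM; try exact: cvg_cst.
    apply: (@continuous_comp _ _ _ (fun p : R => p / q) (fun y => y * ln y)).
      by apply: cvgM; [exact: cvg_id|exact: cvg_cst].
    exact: continuous_mulr_ln.
  apply: (@continuous_comp _ _ _ (fun p : R => (1 - p) / (1 - q))
    (fun y => y * ln y)); last exact: continuous_mulr_ln.
  apply: cvgM; last exact: cvg_cst.
  by apply: cvgB; [exact: cvg_cst|exact: cvg_id].
by rewrite fq f1 min_l ?max_r ?v0 ?v1// (le_trans v0 v1).
Qed.

(** * Integration of the log-density *)

(* The convention +oo - +oo = -oo makes [le_integral] hold without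
   integrability. *)
Lemma le_integral_measurable (d : measure_display) (T : measurableType d)
    (R : realType) (mu : {measure set T -> \bar R}) (D : set T)
    (f g : T -> \bar R) :
  measurable D -> measurable_fun D f -> measurable_fun D g ->
  (forall x, D x -> f x <= g x)%E ->
  (\int[mu]_(x in D) f x <= \int[mu]_(x in D) g x)%E.
Proof.
move=> mD mf mg fg; rewrite integralE [leRHS]integralE leeB//.
- apply: ge0_le_integral => //; [exact: measurable_funepos..|].
  by move=> x Dx; apply: (funepos_le _ (mem_set Dx)) => y /set_mem; exact: fg.
- apply: ge0_le_integral => //; [exact: measurable_funeneg..|].
  by move=> x Dx; apply: (funeneg_le _ (mem_set Dx)) => y /set_mem; exact: fg.
Qed.

Lemma log_sum_inequality (d : measure_display) (T : measurableType d)
    (R : realType) (P : probability T R) (h : T -> R) (E : set T) (q : R) :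
  measurable E -> measurable_fun setT h -> 0 < q ->
  (\int[P]_(x in E) (expR (- h x))%:E <= q%:E)%E ->
  ((fine (P E) * ln (fine (P E) / q))%:E <= \int[P]_(x in E) (h x)%:E)%E.
Proof.
move=> mE mh q0 hq; set p := fine (P E).
have Pp : (P : {measure set T -> \bar R}) E = p%:E.
  by rewrite fineK// fin_num_measure.
have p0 : 0 <= p by rewrite fine_ge0.
have mhE : measurable_fun E (EFin \o h).
  exact/measurable_EFinP/measurable_funTS.
(* The tangent point [c = p / q] must be positive; when [p = 0] both sides are 0. *)
have [pE0|pn0] := eqVneq p 0.
  by rewrite pE0 mul0r null_set_integral//; rewrite Pp pE0.
have {pn0}p0 : 0 < p by rewrite lt_neqAle eq_sym pn0.
pose c := p / q; have c0 : 0 < c by rewrite divr_gt0.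
have mu : measurable_fun setT (fun x => expR (- h x)).
  by apply: measurableT_comp => //; apply: measurableT_comp.
have iu : P.-integrable E (fun x => (expR (- h x))%:E).
  apply/integrableP; split; first exact/measurable_EFinP/measurable_funTS.
  under eq_integral do rewrite gee0_abs ?lee_fin ?expR_ge0//.
  by rewrite (le_lt_trans hq)// ltry.
have icu := integrableZl mE c iu.
have icst := finite_measure_integrable_cst P (ln c + 1) mE.
(* The tangent bound integrates to at least [p * (ln c + 1) - c * q], which is [p * ln c] because
   [c * q = p]. *)
apply: (@le_trans _ _ (\int[P]_(x in E)
    ((ln c + 1)%:E - c%:E * (expR (- h x))%:E))%E).
  rewrite integralB// integralZl// integral_cst// Pp.
  have iufin : (\int[P]_(x in E) (expR (- h x))%:E)%E \is a fin_num.
    exact: integrable_fin_num.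
  rewrite -(fineK iufin) in hq *.
  move: hq; rewrite -!EFinM -EFinB !lee_fin => hq.
  have : c * fine (\int[P]_(x in E) (expR (- h x))%:E) <= p.
    apply: (le_trans (ler_wpM2l (ltW c0) hq)).
    by rewrite /c divfK// gt_eqF.
  by rewrite -/c; lra.
apply: le_integral_measurable => //.
  exact: measurable_int (integrableB mE icst icu).
move=> x Ex; rewrite -EFinM -EFinB lee_fin.
(* The tangent bound is [1 + t <= expR t] at [t = ln c - h x]. *)
have := expR_ge1Dx (ln c - h x).
by rewrite expRD lnK ?posrE//; lra.
Qed.

(** Trades the derivative in the definition for a version that is finite and nonnegative everywhere.
    The two agree [Q]-almost everywhere, hence [P]-almost everywhere by domination. *)
Lemma kl_divergenceE (d : measure_display) (T : measurableType d)
    (R : realType) (P Q : probability T R) : P `<< Q ->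
  exists h : T -> R, [/\ measurable_fun setT h,
    kl_divergence P Q = (\int[P]_x (h x)%:E)%E &
    forall E, measurable E -> (\int[P]_(x in E) (expR (- h x))%:E <= Q E)%E].
Proof.
move=> PQ.
pose g := Radon_Nikodym_SigmaFinite.f P Q.
have g0 x : (0 <= g x)%E by exact: Radon_Nikodym_SigmaFinite.f_ge0.
have gfin x : g x \is a fin_num by exact: Radon_Nikodym_SigmaFinite.f_fin_num.
have mg : measurable_fun setT g.
  exact: (measurable_int Q (Radon_Nikodym_SigmaFinite.f_integrable PQ)).
have mln (f : T -> \bar R) : measurable_fun setT f ->
    measurable_fun setT (fun x => ln (fine (f x))).
  move=> mf; apply: measurableT_comp; first exact: measurable_ln.
  by apply: measurableT_comp.
(* Where g = 0, [ln] returns the junk value 0 and e^(-h) * g = 0 <= 1. *)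
exists (fun x => ln (fine (g x))); split; first exact: mln.
  rewrite /kl_divergence; case: pselect => // PQ'.
  apply: ae_eq_integral => //.
  - apply/measurable_EFinP/mln.
    by apply: (measurable_int Q); exact: Radon_Nikodym_integrable.
  - exact/measurable_EFinP/mln.
  apply: (@ae_eq_comp _ _ _ _ _ _ _ (fun y => (ln (fine y))%:E)).
  apply: ae_eq_sym; apply: (null_dominates_ae_eq measurableT PQ).
  exact: ae_eq_Radon_Nikodym_SigmaFinite.
move=> E mE.
have mu : measurable_fun E (fun x => (expR (- ln (fine (g x))))%:E).
  apply/measurable_EFinP/measurable_funTS.
  apply: measurableT_comp => //; apply: measurableT_comp => //; exact: mln.
(* The left side becomes the [Q]-integral of [expR (- h x)] times [g x], a product at most 1. *)
rewrite -(Radon_Nikodym_SigmaFinite.change_of_variables PQ)//.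
rewrite -[leRHS]mul1e -integral_cst//.
apply: ge0_le_integral => //.
- by move=> x _; rewrite mule_ge0.
- by apply: emeasurable_funM => //; exact: measurable_funTS.
move=> x _ /=; rewrite -/g -(fineK (gfin x)) -EFinM lee_fin.
have := g0 x; rewrite -(fineK (gfin x)) lee_fin le_eqVlt => /predU1P[<-|gx0].
  by rewrite mulr0.
by rewrite expRN lnK ?posrE// mulVf// gt_eqF.
Qed.

(** Data processing inequality for the indicator of [E]. *)
Lemma binary_kl_le_kl_divergence (d : measure_display) (T : measurableType d)
    (R : realType) (P Q : probability T R) (E : set T) :
  measurable E -> (0 < Q E < 1)%E ->
  ((binary_kl (fine (P E)) (fine (Q E)))%:E <= kl_divergence P Q)%E.
Proof.
move=> mE QE; case: (pselect (P `<< Q)) => PQ; last first.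
  by rewrite /kl_divergence; case: pselect => // ?; rewrite leey.
have [h [mh -> hQ]] := kl_divergenceE PQ.
have mCE : measurable (~` E) by exact: measurableC.
have fineC (P' : probability T R) : fine (P' (~` E)) = 1 - fine (P' E).
  by rewrite probability_setC// fineB// fin_num_measure.
have QC := fineC Q; have PC := fineC P.
have Qfin A : measurable A -> Q A = (fine (Q A))%:E.
  by move=> mA; rewrite fineK// fin_num_measure.
move: QE; rewrite (Qfin E mE) !lte_fin => /andP[q0 q1].
have hE : ((fine (P E) * ln (fine (P E) / fine (Q E)))%:E <=
    \int[P]_(x in E) (h x)%:E)%E.
  by apply: (log_sum_inequality mE mh) => //; rewrite -Qfin// hQ.
have hCE : ((fine (P (~` E)) * ln (fine (P (~` E)) / fine (Q (~` E))))%:E <=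
    \int[P]_(x in ~` E) (h x)%:E)%E.
  apply: (log_sum_inequality mCE mh); first by rewrite QC subr_gt0.
  by rewrite -Qfin// hQ.
rewrite QC PC in hCE.
rewrite -(setUv E) integral_setU//.
- by rewrite /binary_kl EFinD; exact: leeD.
- by rewrite setUv; apply/measurable_EFinP.
- by apply/disj_setPS; rewrite setICr.
Qed.

(** The whole space with [q = 1] in [log_sum_inequality]. It places the divergence in the range of
    [f_ q]. *)
Lemma kl_divergence_ge0 (d : measure_display) (T : measurableType d)
    (R : realType) (P Q : probability T R) : (0 <= kl_divergence P Q)%E.
Proof.
case: (pselect (P `<< Q)) => PQ; last first.
  by rewrite /kl_divergence; case: pselect => // ?; rewrite leey.
have [h [mh -> hQ]] := kl_divergenceE PQ.
have := @log_sum_inequality _ _ _ P h setT 1 measurableT mh ltr01.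
rewrite !probability_setT divr1 ln1 mulr0; apply.
by rewrite -(probability_setT Q) hQ.
Qed.

Lemma kl_divergence_bound (d : measure_display) (T : measurableType d)
    (R : realType) (P Q : probability T R) (E : set T) :
  measurable E -> (0 < Q E < 1)%E ->
  (kl_divergence P Q <= (ln (1 / fine (Q E)))%:E)%E ->
  (P E <= (finv_ (fine (Q E)) (fine (kl_divergence P Q)))%:E)%E.
Proof.
move=> mE QE Dle.
have Dge := binary_kl_le_kl_divergence P mE QE.
have D0 := kl_divergence_ge0 P Q.
have Dfin : kl_divergence P Q \is a fin_num.
  by rewrite ge0_fin_numE// (le_lt_trans Dle)// ltry.
have Qfin : Q E = (fine (Q E))%:E by rewrite fineK// fin_num_measure.
have Pfin : P E = (fine (P E))%:E by rewrite fineK// fin_num_measure.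
have p1 : fine (P E) <= 1 by rewrite -lee_fin -Pfin probability_le1.
move: QE Dle Dge D0; rewrite Pfin Qfin -(fineK Dfin) !lte_fin !lee_fin /=.
set q := fine (Q E); set p := fine (P E) in p1 *.
set D := fine _ => q01 Dle Dge D0.
have fmono := f_strictly_increasing q01.
have Drange : (f_ q @` `[q, 1]) D by rewrite f_image//= in_itv/= D0.
have fK : f_ q (finv_ q D) = D by rewrite /finv_ pinvK// inE.
have inj : {in `[q, 1]%classic &, injective (f_ q)}.
  move=> x y /[!inE] xq yq fxy; have [xy|yx|//] := ltgtP x y.
    by have := fmono _ _ xq yq xy; rewrite fxy ltxx.
  by have := fmono _ _ yq xq yx; rewrite fxy ltxx.
have : `[q, 1]%classic (finv_ q D).
  by have [+ _ _] := injpinv_bij (fun=> point) inj; apply.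
rewrite /= => invq; have := invq; rewrite in_itv/= => /andP[qinv _].
(* Below [q] the bound is trivial, as the inverse takes values in [[q, 1]]. Otherwise
   [finv_ q D < p] would force [D < f_ q p], against data processing. *)
have [pq|qp] := ltP p q; first by rewrite (le_trans (ltW pq)).
rewrite leNgt; apply/negP => invp.
have pq1 : p \in `[q, 1] by rewrite in_itv/= qp.
by have := fmono _ _ invq pq1 invp; rewrite fK ltNge Dge.
Qed.

Theorem proposition1 (R : realType) :
  [/\ (forall q : R, 0 < q < 1 ->
        {in `[q, 1] &, {homo f_ q : x y / x < y}} /\
        f_ q @` `[q, 1] = `[0, ln (1 / q)]%classic),
      (forall (d : measure_display) (Z : measurableType d)
          (P Q : probability Z R) (E : set Z),
        measurable E ->
        (0 < Q E < 1)%E ->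
        (kl_divergence P Q <= (ln (1 / fine (Q E)))%:E)%E ->
        (P E <= (finv_ (fine (Q E)) (fine (kl_divergence P Q)))%:E)%E) &
      (forall (d1 d2 : measure_display) (X : measurableType d1)
          (Y : measurableType d2) (PXY : probability (X * Y)%type R)
          (E : set (X * Y)),
        measurable E ->
        (0 < product_of_marginals PXY E < 1)%E ->
        (mutual_information PXY
           <= (ln (1 / fine (product_of_marginals PXY E)))%:E)%E ->
        (PXY E <= (finv_ (fine (product_of_marginals PXY E))
                     (fine (mutual_information PXY)))%:E)%E)].
Proof.
split => [q q01|d Z P Q E|d1 d2 X Y PXY E].
- by split; [exact: f_strictly_increasing|exact: f_image].
- exact: kl_divergence_bound.
(* Mutual information unfolds to a divergence from [product_of_marginals]. *)
- exact: kl_divergence_bound.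
Qed.
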